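(* Let $\epsilon$ be a valuation, $\mathbf p,\mathbf p_1,\mathbf p_2$ expectation lower bounds (functions from valuations to $[0,1]$), $s$ a pGCL program, and $\varphi_1,\varphi_2$ well-formed pDL formulae. Then: 1. (p-box conjunction) If $\epsilon\models[s]_{\mathbf p_1}\,\varphi_1$ and $\epsilon\models[s]_{\mathbf p_2}\,\varphi_2$, then $\epsilon\models[s]_{\mathbf p}\,(\varphi_1\wedge\varphi_2)$, where $\mathbf p=\max(\mathbf p_1+\mathbf p_2-1,\,0)$ everywhere. 2. (p-box disjunction) If $\epsilon\models[s]_{\mathbf p_1}\,\varphi_1$ or $\epsilon\models[s]_{\mathbf p_2}\,\varphi_2$, then $\epsilon\models[s]_{\mathbf p}\,(\varphi_1\vee\varphi_2)$, where $\mathbf p=\min(\mathbf p_1,\mathbf p_2)$ everywhere.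
   Context: **Programs (pGCL).** Fix a set $X$ of program variables. Expressions $e$ are built from program variables and primitive values (Booleans, numbers, ...) with the usual unary/binary arithmetic, comparison and logical operators; they are assumed well-formed, and $\epsilon(e)$ denotes the value of $e$ in a valuation $\epsilon$ (a map from program variables to values). Programs are $$s ::= s\sqcap s \mid s\,{}_{e}\!\oplus s\mid s;s\mid \mathtt{skip}\mid x:=e\mid \mathtt{if}\ e\ \{s\}\ \mathtt{else}\ \{s\}\mid\mathtt{while}\ e\ \{s\},$$ where $\sqcap$ is demonic (non-deterministic) choice and ${}_e\oplus$ is probabilistic choice (left branch with probability given by the value of $e$). **MDP semantics.** A program $s$ denotes a Markov decision process $\mathcal M_s$ with states $\langle\epsilon,s'\rangle$ (valuation, program). A positional policy $\pi$ maps states to available actions; the only states with more than one action are those where a demonic choice is to be resolved, and $\pi\langle\epsilon,s_1\sqcap s_2\rangle\in\{s_1,s_2\}$. For a policy $\pi$, the probabilistic transitions $\sigma\xrightarrow{p}_\pi\sigma'$ are given by the rules: - $\langle\epsilon,x:=e\rangle\xrightarrow{1}_\pi\langle\epsilon[x\mapsto\epsilon(e)],\mathtt{skip}\rangle$; - if $\epsilon(e)=p\in[0,1]$: $\langle\epsilon,s_1\,{}_e\!\oplus s_2\rangle\xrightarrow{p}_\pi\langle\epsilon,s_1\rangle$ and $\langle\epsilon,s_1\,{}_e\!\oplus s_2\rangle\xrightarrow{1-p}_\pi\langle\epsilon,s_2\rangle$ (probabilities are added if the targets coincide); - if $\pi\langle\epsilon,s_1\sqcap s_2\rangle=s_i$: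 $\langle\epsilon,s_1\sqcap s_2\rangle\xrightarrow{1}_\pi\langle\epsilon,s_i\rangle$; - if $\langle\epsilon,s_1\rangle\xrightarrow{p}_\pi\langle\epsilon',s_2\rangle$: $\langle\epsilon,\mathtt{skip};s_1\rangle\xrightarrow{p}_\pi\langle\epsilon',s_2\rangle$ and $\langle\epsilon,s_1;s\rangle\xrightarrow{p}_\pi\langle\epsilon',s_2;s\rangle$; - $\langle\epsilon,\mathtt{if}\ e\ \{s_1\}\ \mathtt{else}\ \{s_2\}\rangle\xrightarrow{1}_\pi\langle\epsilon,s_1\rangle$ if $\epsilon(e)=\mathit{true}$, and $\xrightarrow{1}_\pi\langle\epsilon,s_2\rangle$ if $\epsilon(e)=\mathit{false}$; - $\langle\epsilon,\mathtt{while}\ e\ \{s\}\rangle\xrightarrow{1}_\pi\langle\epsilon,s;\mathtt{while}\ e\ \{s\}\rangle$ if $\epsilon(e)=\mathit{true}$, and $\xrightarrow{1}_\pi\langle\epsilon,\mathtt{skip}\rangle$ if $\epsilon(e)=\mathit{false}$. A state is final if it has no transitions; the state $\langle\epsilon,\mathtt{skip}\rangle$ is final. Standing assumption: every program considered (every program occurring inside a box) reaches, from every initial valuation and under every policy, a state of the form $\langle\epsilon',\mathtt{skip}\rangle$ with probability $1$. **Expectations.** A path is a finite sequence of states $\sigma_1,\dots,\sigma_n$ with consecutive positive-probability transitions under $\pi$ ending in a final state $\mathrm{final}(\overline\sigma)=\sigma_n$; $\Pr(\overline\sigma)$ is the product of its transition probabilities (equal to $1$ for a one-state path), and $\mathrm{paths}_\pi(\sigma)$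 is the set of paths from $\sigma$. For a reward $r$ with values in $[0,1]$ on final states, $$\mathbb E_{\sigma,\pi}\,r=\sum_{\overline\sigma\in\mathrm{paths}_\pi(\sigma)}\Pr(\overline\sigma)\,r(\mathrm{final}(\overline\sigma)),\qquad \mathbf E_\sigma\,r=\inf_\pi\mathbb E_{\sigma,\pi}\,r .$$ A function of valuations is regarded as a reward by evaluating it on the valuation of the final state. **Logic (pDL).** Let $L$ be a set of logical variables disjoint from $X$; each $l\in L$ has a domain $\mathrm{dom}\,l$ of values. Formulae are $$\varphi::=\text{atomic formula}\mid\neg\varphi\mid\varphi_1\wedge\varphi_2\mid\forall l\cdot\varphi\mid[s]_{\mathbf p}\,\varphi,$$ where atomic formulae are built from constants, program variables and logical variables, $s$ is a pGCL program (it mentions no logical variables), and $\mathbf p$ is an expectation lower bound, i.e. a function from valuations of program variables to $[0,1]$. $\to,\vee,\exists$ are derived as usual. A formula is well-formed if it has no free logical variables. Satisfaction $\epsilon\models\varphi$ is defined by: standard satisfaction for atomic formulae; the classical clauses for $\neg,\wedge$; $\epsilon\models\forall l\cdot\varphi$ iff $\epsilon\models\varphi[l:=v]$ for each $v\in\mathrm{dom}\,l$; and $$\epsilon\models[s]_{\mathbf p}\,\varphi\quad\text{iff}\quad \mathbf p(\epsilon)\le\mathbf E_{\langle\epsilon,s\rangle}[\![\varphi]\!]\ \text{ in }\mathcal M_s,$$ where $[\![\varphi]\!](\epsilon')=1$ if $\epsilon'\models\varphi$ and $0$ otherwise. *)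

(* Defs.v *)
From HB Require Import structures.
From mathcomp Require Import all_boot all_order all_algebra.
From mathcomp Require Import interval_inference.
From mathcomp Require Import all_classical all_reals all_analysis.

Set Implicit Arguments.
Unset Strict Implicit.
Unset Printing Implicit Defensive.
Import Order.TTheory GRing.Theory Num.Theory.
Local Open Scope ring_scope.
Local Open Scope classical_set_scope.

(* [D] collects whatever primitive values there are besides Booleans and
   numbers. *)
Inductive value (R D : Type) : Type :=
| VBool of bool
| VNum of R
| VOther of D.
Arguments VBool {R D}.
Arguments VNum {R D}.
Arguments VOther {R D}.

(* The primitive values and operators of the expression language are left open.
   Expressions are assumed well-formed, so operators are interpreted by total
   functions. *)
Record signature (R : Type) := Signature {
  prim : Type;
  unop : Type;
  binop : Type;
  unop_sem : unop -> value R prim -> value R prim;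
  binop_sem : binop -> value R prim -> value R prim -> value R prim }.

Section pDL.
Variables (R : realType) (Sg : signature R) (X L : eqType).

Local Notation val := (value R (prim Sg)).

Inductive expr (V : Type) : Type :=
| EConst of val
| EVar of V
| EUn of unop Sg & expr V
| EBin of binop Sg & expr V & expr V.

Fixpoint eval (V : Type) (a : V -> val) (e : expr V) : val :=
  match e with
  | EConst v => v
  | EVar x => a x
  | EUn o e1 => unop_sem o (eval a e1)
  | EBin o e1 e2 => binop_sem o (eval a e1) (eval a e2)
  end.

Definition valuation : Type := X -> val.

Definition update (eps : valuation) (x : X) (v : val) : valuation :=
  fun y => if y == x then v else eps y.

Inductive prog : Type :=
| Demonic of prog & prog
| Prob of expr X & prog & prog (* [Prob e s1 s2] runs s1 with probability e *)
| Seq of prog & prog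
| Skip
| Assign of X & expr X
| If of expr X & prog & prog
| While of expr X & prog.

HB.instance Definition _ := gen_eqMixin prog.
HB.instance Definition _ := gen_choiceMixin prog.
HB.instance Definition _ := gen_eqMixin valuation.
HB.instance Definition _ := gen_choiceMixin valuation.

Definition state : Type := (valuation * prog)%type.

(* An action at a demonic choice is the branch taken.  All other states have at
   most one action, and the value of a policy there is never used. *)
Record policy := Policy {
  action :> state -> prog;
  action_available : forall eps s1 s2,
    action (eps, Demonic s1 s2) = s1 \/ action (eps, Demonic s1 s2) = s2 }.

(* The transitions out of a state, with their probabilities.  In the rule for
   [Seq s1 s2], s1 = Skip hands over to s2; since Skip has no transitions, the
   two rules for sequencing never overlap. *)
Fixpoint steps (pol : policy) (eps : valuation) (s : prog) : seq (R * state) :=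
  match s with
  | Demonic s1 s2 => [:: (1, (eps, pol (eps, Demonic s1 s2)))]
  | Prob e s1 s2 =>
      if eval eps e is VNum p then
        if 0 <= p <= 1 then [:: (p, (eps, s1)); (1 - p, (eps, s2))] else [::]
      else [::]
  | Seq s1 s2 =>
      if s1 is Skip then steps pol eps s2
      else [seq (t.1, (t.2.1, Seq t.2.2 s2)) | t <- steps pol eps s1]
  | Skip => [::]
  | Assign x e => [:: (1, (update eps x (eval eps e), Skip))]
  | If e s1 s2 =>
      match eval eps e with
      | VBool true => [:: (1, (eps, s1))]
      | VBool false => [:: (1, (eps, s2))]
      | _ => [::]
      end
  | While e s1 =>
      match eval eps e with
      | VBool true => [:: (1, (eps, Seq s1 (While e s1)))]
      | VBool false => [:: (1, (eps, Skip))]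
      | _ => [::]
      end
  end.

(* Summing over all transitions with the given target adds up the
   probabilities of a choice whose two branches coincide. *)
Definition trans_prob (pol : policy) (sigma sigma' : state) : R :=
  \sum_(t <- steps pol sigma.1 sigma.2 | t.2 == sigma') t.1.

Definition is_final (pol : policy) (sigma : state) : Prop :=
  steps pol sigma.1 sigma.2 = [::].

(* A path sigma_1, ..., sigma_n from sigma = sigma_1 is represented by its tail
   sigma_2, ..., sigma_n; its final state is [last sigma tail]. *)
Definition paths (pol : policy) (sigma : state) : set (seq state) :=
  [set t | path (fun a b => 0 < trans_prob pol a b) sigma t /\
           is_final pol (last sigma t)].

Fixpoint path_prob (pol : policy) (sigma : state) (t : seq state) : R :=
  if t is sigma' :: t' then
    trans_prob pol sigma sigma' * path_prob pol sigma' t'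
  else 1.

(* Rewards are meant to take values in [0, 1]. *)
Definition expect_pol (pol : policy) (sigma : state) (r : state -> R) : \bar R :=
  \esum_(t in paths pol sigma) (path_prob pol sigma t * r (last sigma t))%:E.

Definition expect (sigma : state) (r : state -> R) : \bar R :=
  ereal_inf (range (fun pol => expect_pol pol sigma r)).

(* States (eps, Skip) are final, so the
   probability of reaching one is that of the paths ending in one. *)
Definition terminating (s : prog) : Prop :=
  forall (eps : valuation) (pol : policy),
    \esum_(t in paths pol (eps, s) `&` [set t | (last (eps, s) t).2 = Skip])
       (path_prob pol (eps, s) t)%:E = 1%E.

Definition expectation_lower_bound : Type := valuation -> {i01 R}.

(* Atomic formulae are Boolean-valued expressions over program variables
   ([inl]) and logical variables ([inr]). *)
Inductive formula : Type :=
| Atom of expr (X + L)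
| Not of formula
| And of formula & formula
| Forall of L & formula
| Box of prog & expectation_lower_bound & formula.

Definition Or (f g : formula) : formula := Not (And (Not f) (Not g)).

Fixpoint efree (l : L) (e : expr (X + L)) : bool :=
  match e with
  | EConst _ => false
  | EVar x => if x is inr l' then l' == l else false
  | EUn _ e1 => efree l e1
  | EBin _ e1 e2 => efree l e1 || efree l e2
  end.

Fixpoint free (l : L) (f : formula) : bool :=
  match f with
  | Atom e => efree l e
  | Not g => free l g
  | And g h => free l g || free l h
  | Forall l' g => (l' != l) && free l g
  | Box _ _ g => free l g
  end.

Definition well_formed (f : formula) : Prop := forall l, ~~ free l f.

Fixpoint esubst (l : L) (v : val) (e : expr (X + L)) : expr (X + L) :=
  match e with
  | EConst c => EConst _ c
  | EVar x =>
      if x is inr l' then if l' == l then EConst _ v else EVar x else EVar x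
  | EUn o e1 => EUn o (esubst l v e1)
  | EBin o e1 e2 => EBin o (esubst l v e1) (esubst l v e2)
  end.

Fixpoint subst (l : L) (v : val) (f : formula) : formula :=
  match f with
  | Atom e => Atom (esubst l v e)
  | Not g => Not (subst l v g)
  | And g h => And (subst l v g) (subst l v h)
  | Forall l' g => if l' == l then f else Forall l' (subst l v g)
  | Box s p g => Box s p (subst l v g)
  end.

Fixpoint boxes_terminating (f : formula) : Prop :=
  match f with
  | Atom _ => True
  | Not g => boxes_terminating g
  | And g h => boxes_terminating g /\ boxes_terminating h
  | Forall _ g => boxes_terminating g
  | Box s _ g => terminating s /\ boxes_terminating g
  end.

Section satisfaction.
Variable dom : L -> set val.

(* The value of a free logical variable is irrelevant: only well-formed
   formulae are interpreted. *)
Definition atom_env (eps : valuation) (x : X + L) : val :=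
  if x is inl y then eps y else VBool false.

Fixpoint depth (f : formula) : nat :=
  match f with
  | Atom _ => 1
  | Not g => (depth g).+1
  | And g h => (maxn (depth g) (depth h)).+1
  | Forall _ g => (depth g).+1
  | Box _ _ g => (depth g).+1
  end.

(* The clause for Forall recurs on a substitution instance, which is not a
   structural subterm; hence the recursion on a bound for the depth.  The
   equations [sat_Atom], ..., [sat_Box] below characterize [sat]. *)
Fixpoint sat_fuel (n : nat) (eps : valuation) (f : formula) : Prop :=
  if n is m.+1 then
    match f with
    | Atom e => eval (atom_env eps) e = VBool true
    | Not g => ~ sat_fuel m eps g
    | And g h => sat_fuel m eps g /\ sat_fuel m eps h
    | Forall l g => forall v, dom l v -> sat_fuel m eps (subst l v g)
    | Box s p g =>
        ((p eps)%:num%:E <=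
         expect (eps, s) (fun sigma => \1_[set eps' | sat_fuel m eps' g] sigma.1))%E
    end
  else False.

Definition sat (eps : valuation) (f : formula) : Prop := sat_fuel (depth f) eps f.

Lemma depth_subst l v f : depth (subst l v f) = depth f.
Proof.
elim: f => //= [g -> //|g -> h -> //|l' g IH|s p g -> //].
by case: ifP => //= _; rewrite IH.
Qed.

Lemma sat_fuelE n eps f : (depth f <= n)%N -> sat_fuel n eps f = sat eps f.
Proof.
suff H k m eps' g : (depth g <= k)%N -> (depth g <= m)%N ->
    sat_fuel k eps' g = sat_fuel m eps' g by move=> ?; exact: H.
elim: k m eps' g => [|k IH] [|m] eps' [e|g|g h|l g|s p g] //=; rewrite !ltnS.
- by move=> gk gm; rewrite (IH m).
- by rewrite !geq_max => /andP[gk hk] /andP[gm hm]; rewrite (IH m) ?(IH m _ h).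
- move=> gk gm; apply: eq_forall => v.
  by rewrite (IH m) ?depth_subst.
- move=> gk gm; do 4 f_equal; apply/funext => sigma.
  by do 2 f_equal; apply/funext => e'; exact: IH.
Qed.

Lemma sat_Atom eps e :
  sat eps (Atom e) = (eval (atom_env eps) e = VBool true).
Proof. by []. Qed.

Lemma sat_Not eps f : sat eps (Not f) = ~ sat eps f.
Proof. by []. Qed.

Lemma sat_And eps f g : sat eps (And f g) = (sat eps f /\ sat eps g).
Proof. by rewrite {1}/sat /= !sat_fuelE ?leq_maxl ?leq_maxr. Qed.

Lemma sat_Forall eps l f :
  sat eps (Forall l f) = (forall v, dom l v -> sat eps (subst l v f)).
Proof.
by rewrite {1}/sat /=; apply: eq_forall => v; rewrite sat_fuelE ?depth_subst.
Qed.

Lemma sat_Box eps s (p : expectation_lower_bound) f :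
  sat eps (Box s p f) =
  ((p eps)%:num%:E <=
   expect (eps, s) (fun sigma => \1_[set eps' | sat eps' f] sigma.1))%E :> Prop.
Proof. by []. Qed.

End satisfaction.
End pDL.

(* Main.v *)
(** For a fixed policy the paths from a state have total mass at most 1: among
    the paths of bounded length this follows by induction on the bound, grouping
    them by their first transition.  Hence, writing M for the total mass,
    1_A + 1_B <= 1_(A /\ B) + 1 integrates to
    E 1_A + E 1_B <= E 1_(A /\ B) + M <= E 1_(A /\ B) + 1
    for every policy, and taking infima gives the conjunction rule; the
    disjunction rule is monotonicity of expectations. *)
Require Import Defs.
From mathcomp Require Import all_boot all_order all_algebra.
From mathcomp Require Import interval_inference finmap.
From mathcomp Require Import all_classical all_reals all_analysis.

Set Implicit Arguments.
Unset Strict Implicit.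
Unset Printing Implicit Defensive.
Local Open Scope ring_scope.

Import Order.TTheory GRing.Theory Num.Theory.

(** After exchanging the sums, each [i] is counted once, since [K] has no duplicates and contains
    [h i]. This groups paths by first successor and transitions by target. *)
Lemma partition_big_seq (M : nmodType) (I J : eqType) (r : seq I) (K : seq J)
    (h : I -> J) (f : I -> M) :
  uniq K -> (forall i, i \in r -> h i \in K) ->
  \sum_(i <- r) f i = \sum_(j <- K) \sum_(i <- r | h i == j) f i.
Proof.
move=> uniq_K hK; rewrite (exchange_big_dep predT) //= [LHS]big_seq [RHS]big_seq.
apply: eq_bigr => i ir; rewrite -big_filter (eq_filter (a2 := pred1 (h i))).
  by rewrite filter_pred1_uniq ?hK // big_seq1.
by move=> j /=; rewrite eq_sym.
Qed.

Section ExpectationBounds.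
Variables (R : realType) (Sg : signature R) (X : eqType).
Implicit Types (pol : policy Sg X) (sigma : state Sg X) (s : prog Sg X).

Lemma steps_ge0 pol eps s t : t \in steps pol eps s -> 0 <= t.1.
Proof.
elim: s t => [s1 _ s2 _|e s1 _ s2 _|s1 IH1 s2 IH2||x e|e s1 _ s2 _|e s1 _] t //=.
- by rewrite inE => /eqP ->.
- case: (Defs.eval eps e) => [?|q|?] //; case: ifP => // /andP[q0 q1].
  by rewrite !inE => /orP[] /eqP -> //=; rewrite subr_ge0.
(* Proved before splitting on [s1], so that one argument serves every constructor except [Skip]. *)
- have H : t \in [seq (t.1, (t.2.1, Seq t.2.2 s2)) | t <- steps pol eps s1] ->
      0 <= t.1 by move=> /mapP[u /IH1 u0 ->].
  by case: s1 H {IH1} => // _; exact: IH2.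
- by rewrite inE => /eqP ->.
- by case: (Defs.eval eps e) => // -[]; rewrite inE => /eqP ->.
- by case: (Defs.eval eps e) => // -[]; rewrite inE => /eqP ->.
Qed.

(** Equality can fail: [Skip] and stuck programs have no transitions, so their sum is 0. *)
Lemma sum_steps_le1 pol eps s : \sum_(t <- steps pol eps s) t.1 <= 1.
Proof.
elim: s => [s1 _ s2 _|e s1 _ s2 _|s1 IH1 s2 IH2||x e|e s1 _ s2 _|e s1 _] /=.
- by rewrite big_seq1.
- case: (Defs.eval eps e) => [?|q|?]; rewrite ?big_nil //.
  case: ifP => _; last by rewrite big_nil.
  by rewrite big_cons big_seq1 /= addrC subrK.
- have H : \sum_(t <- [seq (t.1, (t.2.1, Seq t.2.2 s2)) | t <- steps pol eps s1])
      t.1 <= 1 by rewrite big_map.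
  by case: s1 H {IH1}.
- by rewrite big_nil.
- by rewrite big_seq1.
- by case: (Defs.eval eps e) => [[]|?|?]; rewrite ?big_seq1 ?big_nil.
- by case: (Defs.eval eps e) => [[]|?|?]; rewrite ?big_seq1 ?big_nil.
Qed.

Lemma trans_prob_ge0 pol sigma sigma' : 0 <= trans_prob pol sigma sigma'.
Proof. by rewrite /trans_prob big_seq_cond sumr_ge0 // => t /andP[/steps_ge0]. Qed.

Lemma trans_prob_gt0_mem pol sigma sigma' : 0 < trans_prob pol sigma sigma' ->
  sigma' \in [seq t.2 | t <- steps pol sigma.1 sigma.2].
Proof.
apply: contraTT => /negP Hn; rewrite /trans_prob big_seq_cond big1 ?ltxx //.
by move=> t /andP[tin /eqP te]; case: Hn; rewrite -te map_f.
Qed.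

Lemma path_prob_ge0 pol sigma t : 0 <= path_prob pol sigma t.
Proof.
by elim: t sigma => //= a t IH sigma; rewrite mulr_ge0 // trans_prob_ge0.
Qed.

(** Such an [F] has at most one entry, the one-state path of probability 1. This covers both the
    length bound 0 and a final [sigma]. *)
Lemma sum_path_prob_nil_le1 pol sigma (F : seq (seq (state Sg X))) :
  uniq F -> (forall t, t \in F -> t = [::]) ->
  \sum_(t <- F) path_prob pol sigma t <= 1.
Proof.
move=> uniq_F F_nil; have sub : {subset F <= [:: [::]]} by move=> t /F_nil ->.
case: F {F_nil} uniq_F sub (uniq_leq_size uniq_F sub) => [|a [|//]] _ sub _.
  by rewrite big_nil.
by have /[!inE]/eqP -> := sub a (mem_head _ _); rewrite big_seq1.
Qed.

Lemma sum_path_prob_le1 pol sigma (F : seq (seq (state Sg X))) :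
  uniq F -> (forall t, t \in F -> paths pol sigma t) ->
  \sum_(t <- F) path_prob pol sigma t <= 1.
Proof.
have [n] : exists n, forall t, t \in F -> (size t <= n)%N.
  by exists (\max_(t <- F) size t)%N => t tF; exact: leq_bigmax_seq.
elim: n sigma F => [|n IH] sigma F size_F uniq_F path_F.
  apply: sum_path_prob_nil_le1 => // t tF.
  by apply/nilP; rewrite /nilp -leqn0; exact: size_F.
(* An empty tail in [F] makes [sigma] final, so no nonempty tail can start from it. *)
have [nilF|nilNF] := boolP ([::] \in F).
  apply: sum_path_prob_nil_le1 => // -[//|a t] /path_F[/= /andP[+ _] _].
  by move=> /trans_prob_gt0_mem; have [_ /= ->] := path_F _ nilF.
(* Coinciding branches repeat a target in [S], hence [undup]. The default of [head] below is never
   reached, as [F] has no empty tail. *)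
set S := steps pol sigma.1 sigma.2; pose T := undup [seq t.2 | t <- S].
have head_T t : t \in F -> head sigma t \in T.
  case: t => [|a t] tF; first by rewrite tF in nilNF.
  have [/= /andP[/trans_prob_gt0_mem aS _] _] := path_F _ tF.
  by rewrite mem_undup.
(* The first transition factors out; the remaining tails are distinct, shorter paths from [x], to
   which the induction hypothesis applies. *)
have sum_head x : \sum_(t <- F | head sigma t == x) path_prob pol sigma t <=
    trans_prob pol sigma x.
  pose Fx := [seq behead t | t <- F & head sigma t == x].
  have cons_F t : t \in F -> head sigma t == x -> t = x :: behead t.
    by case: t => [|a t] tF /eqP /= => [_|->//]; rewrite tF in nilNF.
  have -> : \sum_(t <- F | head sigma t == x) path_prob pol sigma t =
      trans_prob pol sigma x * \sum_(t <- Fx) path_prob pol x t.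
    rewrite big_map big_filter mulr_sumr big_seq_cond [RHS]big_seq_cond.
    by apply: eq_bigr => t /andP[tF tx]; rewrite {1}(cons_F _ tF tx).
  rewrite -[leRHS]mulr1 ler_wpM2l ?trans_prob_ge0 //; apply: IH.
  - move=> _ /mapP[t + ->]; rewrite mem_filter => /andP[tx tF].
    by have := size_F _ tF; rewrite (cons_F _ tF tx).
  - rewrite map_inj_in_uniq ?filter_uniq // => t u.
    rewrite !mem_filter => /andP[tx tF] /andP[ux uF] tu.
    by rewrite (cons_F _ tF tx) (cons_F _ uF ux) tu.
  - move=> _ /mapP[t + ->]; rewrite mem_filter => /andP[tx tF].
    by have := path_F _ tF; rewrite (cons_F _ tF tx) => -[/= /andP[]].
rewrite (partition_big_seq _ (h := head sigma) (K := T)) ?undup_uniq //.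
apply: le_trans (sum_steps_le1 pol sigma.1 sigma.2).
(* Grouped by target, the transition weights are the [trans_prob] values bounding the groups of
   paths. *)
rewrite (partition_big_seq _ (h := snd) (K := T)) ?undup_uniq //; first exact: ler_sum.
by move=> t tS; rewrite mem_undup map_f.
Qed.

Lemma esum_path_prob_le1 pol sigma :
  (\esum_(t in paths pol sigma) (path_prob pol sigma t)%:E <= 1)%E.
Proof.
(* [\esum] is a supremum of finite partial sums, each bounded by the lemma on lists. *)
apply: ge_ereal_sup => _ [F [finF FP] <-].
rewrite fsbig_finite //= sumEFin lee_fin.
apply: sum_path_prob_le1 => [|t]; first exact: fset_uniq.
by rewrite in_fset_set // inE => /FP.
Qed.

Lemma expect_pol_ge0 pol sigma (r : state Sg X -> R) :
  (forall x, 0 <= r x) -> (0 <= expect_pol pol sigma r)%E.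
Proof.
by move=> r0; apply: esum_ge0 => t _; rewrite lee_fin mulr_ge0 ?path_prob_ge0.
Qed.

Lemma le_expect sigma (r1 r2 : state Sg X -> R) :
  (forall x, r1 x <= r2 x) -> (expect sigma r1 <= expect sigma r2)%E.
Proof.
move=> r12; apply: le_ereal_inf_tmp => _ [pol _ <-].
apply: ge_ereal_inf; exists (expect_pol pol sigma r1); first by exists pol.
by apply: le_esum => t _; rewrite lee_fin ler_wpM2l ?path_prob_ge0.
Qed.

Lemma expect_ge_add sigma (r1 r2 r : state Sg X -> R) (q1 q2 : R) :
  (forall x, 0 <= r1 x) -> (forall x, 0 <= r2 x) -> (forall x, 0 <= r x) ->
  (forall x, r1 x + r2 x <= r x + 1) ->
  (q1%:E <= expect sigma r1)%E -> (q2%:E <= expect sigma r2)%E ->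
  ((Num.max (q1 + q2 - 1) 0)%:E <= expect sigma r)%E.
Proof.
move=> r1_ge0 r2_ge0 r_ge0 r12 q1E q2E; apply: le_ereal_inf_tmp => _ [pol _ <-].
have q1P : (q1%:E <= expect_pol pol sigma r1)%E.
  by apply: le_trans q1E _; apply: ereal_inf_lbound; exists pol.
have q2P : (q2%:E <= expect_pol pol sigma r2)%E.
  by apply: le_trans q2E _; apply: ereal_inf_lbound; exists pol.
rewrite EFin_max ge_max expect_pol_ge0 // andbT EFinB leeBlDr // EFinD.
apply: le_trans (leeD q1P q2P) _.
(* Replacing 1 by the total mass makes both sides sums over the same paths, which are then compared
   termwise. *)
apply: le_trans (leeD (le_refl _) (esum_path_prob_le1 pol sigma)).
have pr_ge0 (f : state Sg X -> R) t : (forall x, 0 <= f x) ->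
    (0 <= (path_prob pol sigma t * f (last sigma t))%:E)%E.
  by move=> f0; rewrite lee_fin mulr_ge0 ?path_prob_ge0.
rewrite /expect_pol -!esumD; try by [move=> t _; exact: pr_ge0 |
  move=> t _; rewrite lee_fin path_prob_ge0].
apply: le_esum => t _; rewrite -!EFinD lee_fin -[X in _ <= _ + X]mulr1 -!mulrDr.
by rewrite ler_wpM2l ?path_prob_ge0.
Qed.

End ExpectationBounds.

Theorem theorem5 (R : realType) (Sg : signature R) (X L : eqType)
    (dom : L -> set (value R (prim Sg)))
    (eps : valuation Sg X)
    (p p1 p2 : expectation_lower_bound Sg X) (s : prog Sg X)
    (phi1 phi2 : formula Sg X L)
    (phi1_wf : well_formed phi1) (phi2_wf : well_formed phi2)
    (s_term : terminating s)
    (phi1_term : boxes_terminating phi1) (phi2_term : boxes_terminating phi2) :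
  ((forall eps', (p eps')%:num
      = Num.max ((p1 eps')%:num + (p2 eps')%:num - 1) 0) ->
   sat dom eps (Box s p1 phi1) -> sat dom eps (Box s p2 phi2) ->
   sat dom eps (Box s p (And phi1 phi2))) /\
  ((forall eps', (p eps')%:num = Num.min (p1 eps')%:num (p2 eps')%:num) ->
   sat dom eps (Box s p1 phi1) \/ sat dom eps (Box s p2 phi2) ->
   sat dom eps (Box s p (Or phi1 phi2))).
Proof.
split=> pE; rewrite !sat_Box pE.
- apply: expect_ge_add => x; rewrite !indicE ?ler0n //.
  have -> : [set e | sat dom e (And phi1 phi2)]%classic =
      ([set e | sat dom e phi1] `&` [set e | sat dom e phi2])%classic.
    by apply/seteqP; split=> e /=; rewrite sat_And.
  rewrite in_setI.
  by do 2![case: (_ \in _)]; rewrite /= ?addr0 ?add0r.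
- have indic_le phi : (forall e, sat dom e phi -> sat dom e (Or phi1 phi2)) ->
      forall x : state Sg X, \1_[set e | sat dom e phi]%classic x.1 <=
        \1_[set e | sat dom e (Or phi1 phi2)]%classic x.1 :> R.
    move=> phi_Or x; rewrite !indicE ler_nat.
    case: (boolP (x.1 \in [set e | sat dom e phi]%classic)) => // /set_mem phix.
    by rewrite mem_set //=; exact: phi_Or.
  (* A minimum lies below a bound as soon as one argument does, so either disjunct of [H]
     suffices. *)
  rewrite EFin_min ge_min => H; apply/orP.
  case: H => /le_trans H; [left|right]; apply: H; apply: le_expect; apply: indic_le.
    by move=> e; rewrite /Or sat_Not sat_And !sat_Not => + [].
  by move=> e; rewrite /Or sat_Not sat_And !sat_Not => + [].
Qed.
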